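(* Let $\mathcal C$ be an $(n,k)$ linear code over $\mathrm{GF}(q^m)$ (a $k$-dimensional $\mathrm{GF}(q^m)$-subspace of $\mathrm{GF}(q^m)^n$) and $\mathcal C^\perp$ its dual. Let $W^{\mathrm R}_{\mathcal C}(x,y)=\sum_{i=0}^n A_i y^i x^{n-i}$ and $W^{\mathrm R}_{\mathcal C^\perp}(x,y)=\sum_{j=0}^n B_j y^j x^{n-j}$ be their rank weight enumerators. Then $$W^{\mathrm R}_{\mathcal C^\perp}(x,y)=\frac{1}{|\mathcal C|}\,\bar W^{\mathrm R}_{\mathcal C}\big(x+(q^m-1)y,\;x-y\big),$$ where $\bar W^{\mathrm R}_{\mathcal C}$ is the $q$-transform of $W^{\mathrm R}_{\mathcal C}$; equivalently, $$\sum_{j=0}^n B_j y^j x^{n-j}=q^{-mk}\sum_{i=0}^n A_i\,(x-y)^{[i]} * \big[x+(q^m-1)y\big]^{[n-i]}.$$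
   Context: The rank $\mathrm{rk}(\mathbf v)$ of $\mathbf v\in\mathrm{GF}(q^m)^n$ is the maximum number of its coordinates linearly independent over $\mathrm{GF}(q)$. The rank weight enumerator of a code $\mathcal C\subseteq\mathrm{GF}(q^m)^n$ is $W^{\mathrm R}_{\mathcal C}(x,y)=\sum_{\mathbf v\in\mathcal C} y^{\mathrm{rk}(\mathbf v)}x^{n-\mathrm{rk}(\mathbf v)}$. The dual $\mathcal C^\perp$ is taken with respect to the standard inner product $\mathbf u\cdot\mathbf v=\sum_i u_iv_i$ on $\mathrm{GF}(q^m)^n$. $q$-product: consider homogeneous polynomials $a(x,y;m)=\sum_{i=0}^r a_i(m)y^ix^{r-i}$ and $b(x,y;m)=\sum_{j=0}^s b_j(m)y^jx^{s-j}$ whose coefficients are real functions of the parameter $m$ (coefficients with indices out of range are zero). Their $q$-product is the degree-$(r+s)$ homogeneous polynomial $a*b=\sum_{u=0}^{r+s}c_u(m)y^ux^{r+s-u}$ with $c_u(m)=\sum_{i=0}^u q^{is}a_i(m)b_{u-i}(m-i)$. The $q$-powers are $a^{[0]}=1$, $a^{[n]}=a^{[n-1]}*a$. Here $x+(q^m-1)y$ has coefficients $1$ and $q^m-1$ (the latter depending on $m$), and $x-y$ has constant coefficients $1,-1$. The $q$-transform of $a(x,y;m)=\sum_{i=0}^r a_i(m)y^ix^{r-i}$ is $\bar a(x,y;m)=\sum_{i=0}^r a_i(m)\,y^{[i]}*x^{[r-i]}$, and $\bar W(X,Y)$ means this expression with $x$ replaced by $X$ and $y$ by $Y$ (so $\bar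 W^{\mathrm R}_{\mathcal C}(x+(q^m-1)y,x-y)=\sum_i A_i (x-y)^{[i]}*[x+(q^m-1)y]^{[n-i]}$). *)

(* Defs.v *)
From HB Require Import structures.
From mathcomp Require Import all_boot all_order all_algebra.
Set Implicit Arguments. Unset Strict Implicit. Unset Printing Implicit Defensive.
Import Order.TTheory GRing.Theory Num.Theory.
Local Open Scope ring_scope.

Section Rank.
Variables (L : finFieldType) (q n : nat).

Definition Fq : {set L} := [set x : L | x ^+ q == x].

Definition coords_indep (v : 'rV[L]_n) (S : {set 'I_n}) : bool :=
  [forall c : {ffun 'I_n -> L},
     ([forall i in S, c i \in Fq] && (\sum_(i in S) c i * v ord0 i == 0))
       ==> [forall i in S, c i == 0]].

Definition rk (v : 'rV[L]_n) : nat :=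
  \max_(S : {set 'I_n} | coords_indep v S) #|S|.

Definition dotp (u v : 'rV[L]_n) : L := \sum_(i < n) u ord0 i * v ord0 i.

Definition dual_code (C : {vspace 'rV[L]_n}) : {set 'rV[L]_n} :=
  [set u : 'rV[L]_n | [forall v : 'rV[L]_n, (v \in C) ==> (dotp u v == 0)]].

Definition rank_dist (D : {set 'rV[L]_n}) (i : nat) : nat :=
  #|[set v in D | rk v == i]|.

Definition code_set (C : {vspace 'rV[L]_n}) : {set 'rV[L]_n} :=
  [set v : 'rV[L]_n | v \in C].
End Rank.

(* A homogeneous polynomial  sum_{i=0}^r a_i(m) y^i x^(r-i)  is encoded by its
   degree r and the coefficient function (i, m) |-> a_i(m); m ranges over int
   (the q-product evaluates coefficients at shifted parameters m - i). *)
Record hpoly (R : realFieldType) := HPoly { hdeg : nat; hcoef_fun : nat -> int -> R }.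

Section QProduct.
Variables (R : realFieldType) (q : nat).

Definition hcoef (a : hpoly R) (i : nat) (m : int) : R :=
  if (i <= hdeg a)%N then hcoef_fun a i m else 0.

Definition qprod (a b : hpoly R) : hpoly R :=
  HPoly (hdeg a + hdeg b)
    (fun u m => \sum_(0 <= i < u.+1)
        (q%:R ^+ (i * hdeg b)) * hcoef a i m * hcoef b (u - i) (m - i%:Z)).

Definition hone : hpoly R := HPoly 0 (fun _ _ => 1).

Fixpoint qpow (a : hpoly R) (k : nat) : hpoly R :=
  if k is k'.+1 then qprod (qpow a k') a else hone.

Definition hx : hpoly R := HPoly 1 (fun i _ => if i == 0%N then 1 else 0).
Definition hy : hpoly R := HPoly 1 (fun i _ => if i == 0%N then 0 else 1).

Definition hX : hpoly R :=
  HPoly 1 (fun i m => if i == 0%N then 1 else (q%:R : R) ^ m - 1).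
Definition hY : hpoly R := HPoly 1 (fun i _ => if i == 0%N then 1 else -1).

(* q-transform of a, with x replaced by X and y replaced by Y:
   sum_i a_i(m) Y^[i] * X^[r-i]   (homogeneous of degree r when X, Y have degree 1) *)
Definition qtransform_at (a : hpoly R) (X Y : hpoly R) : hpoly R :=
  HPoly (hdeg a)
    (fun u m => \sum_(0 <= i < (hdeg a).+1)
        hcoef a i m * hcoef (qprod (qpow Y i) (qpow X (hdeg a - i))) u m).

End QProduct.

Definition rank_enum (R : realFieldType) (L : finFieldType) (q n : nat)
  (D : {set 'rV[L]_n}) : hpoly R :=
  HPoly n (fun i _ => (rank_dist q D i)%:R).

(* Main.v *)
(** A code C is closed under multiplication by L^*, so averaging the additive
    characters of L over L^* gives a rational-valued function [kappa] with
    sum_(v in C) kappa(u.v) = |C| if u lies in the dual of C, and 0 otherwise.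
    It remains to evaluate K_j(v) = sum_(rk u = j) kappa(u.v).  Splitting off
    the first coordinate b of v = (b, w), and parametrizing the span of u by
    c |-> u.c with c in GF(q)^n, expresses K_(j+1)(b, w) through the values of
    K_(j+1) and K_j at the vectors w + b c (lemma [krank_rvcons]).  If v has
    full rank then so do all the w + b c, and one gets the recursion satisfied
    by the coefficients of (x - y)^[n+1].  Otherwise a GF(q)-linear change of
    coordinates makes b = 0, and one gets the effect of a right q-product by
    x + (q^m - 1) y. *)

Require Import Defs.
From HB Require Import structures.
From mathcomp Require Import all_boot all_order all_algebra all_fingroup all_field ring.
Import Order.TTheory GRing.Theory Num.Theory.
Local Open Scope ring_scope.

(** * Coefficients of q-products and their recursions *)

Section QProductCoefficients.
Set Implicit Arguments.
Unset Strict Implicit.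
Variables (R : realFieldType) (q : nat).
Implicit Types (a b : hpoly R) (m : int).

Lemma hcoef_gt a i m : (hdeg a < i)%N -> hcoef a i m = 0.
Proof. by rewrite /hcoef ltnNge => /negbTE->. Qed.

(** Beyond the total degree, every i has i > [hdeg a] or u - i > [hdeg b], so all terms vanish and
    the formula holds for all u. *)
Lemma hcoef_qprod a b u m :
  hcoef (qprod q a b) u m
    = \sum_(i < u.+1) q%:R ^+ (i * hdeg b) * hcoef a i m
                        * hcoef b (u - i) (m - i%:Z).
Proof.
rewrite /hcoef /=; case: leqP => [_|u_gt]; first by rewrite big_mkord.
rewrite big1 // => i _; have [a_i|a_i] := leqP i (hdeg a).
  by rewrite leqNgt ltn_subRL (leq_ltn_trans _ u_gt) ?mulr0 // leq_add2r.
by rewrite mulr0 mul0r.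
Qed.

Lemma hcoef_qprod0 a b m :
  hcoef (qprod q a b) 0 m = hcoef a 0 m * hcoef b 0 m.
Proof. by rewrite hcoef_qprod big_ord1 mul0n mul1r subr0. Qed.

Lemma hcoef_qprod_linear a b u m : hdeg b = 1%N ->
  hcoef (qprod q a b) u.+1 m
    = q%:R ^+ u.+1 * hcoef a u.+1 m * hcoef b 0 (m - u.+1%:Z)
      + q%:R ^+ u * hcoef a u m * hcoef b 1 (m - u%:Z).
Proof.
move=> deg_b; rewrite hcoef_qprod 2!big_ord_recr /= big1 ?add0r => [|i _].
  by rewrite deg_b !muln1 subnn subSnn addrC.
by rewrite [hcoef b _ _]hcoef_gt ?mulr0 // deg_b ltn_subRL addn1 ltnS.
Qed.

Lemma hdeg_qpow a k : hdeg (qpow q a k) = (k * hdeg a)%N.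
Proof. by elim: k => //= k ->; rewrite mulSn addnC. Qed.

Lemma hcoef_qprod_hone a u m : hcoef (qprod q a (hone R)) u m = hcoef a u m.
Proof.
rewrite hcoef_qprod big_ord_recr /= big1 ?add0r => [|i _].
  by rewrite muln0 mul1r subnn mulr1.
by rewrite [hcoef (hone R) _ _]hcoef_gt ?mulr0 // subn_gt0.
Qed.

Lemma hcoef_qpow0 a k m : hcoef a 0 m = 1 -> hcoef (qpow q a k) 0 m = 1.
Proof. by move=> a0; elim: k => //= k IHk; rewrite hcoef_qprod0 IHk a0 mulr1. Qed.

(** A rank-metric analogue of the Krawtchouk polynomials: with i the rank of a vector and i + k its
    length, this is the value of K_j there ([krankE]). *)
Definition krawtchouk i k j m : R :=
  hcoef (qprod q (qpow q (hY R) i) (qpow q (hX R q) k)) j m.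

Lemma krawtchouk0 i k m : krawtchouk i k 0 m = 1.
Proof. by rewrite /krawtchouk hcoef_qprod0 !hcoef_qpow0 ?mulr1. Qed.

Lemma krawtchouk_gt i k j m : (i + k < j)%N -> krawtchouk i k j m = 0.
Proof. by move=> lt_j; apply: hcoef_gt; rewrite /= !hdeg_qpow !muln1. Qed.

(** At k = 0 the second factor is the unit, and [qpow] exposes a last factor x - y on the right.
    This case serves vectors of full rank. *)
Lemma krawtchouk_Sl i j m :
  krawtchouk i.+1 0 j.+1 m
    = q%:R ^+ j.+1 * krawtchouk i 0 j.+1 m - q%:R ^+ j * krawtchouk i 0 j m.
Proof.
rewrite /krawtchouk !hcoef_qprod_hone [LHS]hcoef_qprod_linear //.
by rewrite /hcoef /= mulr1 mulrN1.
Qed.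

Lemma exprM_exprz_sub l m : q%:R != 0 :> R ->
  q%:R ^+ l * q%:R ^ (m - l%:Z) = q%:R ^ m :> R.
Proof. by move=> q0; rewrite exprnP -expfzDr // addrC subrK. Qed.

(** The factor q^j combined with the shift of the parameter to m - j turns q^m - 1 into q^m -
    q^j. *)
Lemma hcoef_qpow_hX k j m : q%:R != 0 :> R ->
  hcoef (qpow q (hX R q) k.+1) j.+1 m
    = q%:R ^+ j.+1 * hcoef (qpow q (hX R q) k) j.+1 m
      + (q%:R ^ m - q%:R ^+ j) * hcoef (qpow q (hX R q) k) j m.
Proof.
move=> q0; rewrite [LHS]hcoef_qprod_linear // [hcoef (hX _ _) 0 _]/hcoef /=.
rewrite mulr1 [hcoef (hX _ _) 1 _]/hcoef /= mulrAC mulrBr mulr1.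
by rewrite exprM_exprz_sub.
Qed.

(** An instance of associativity, checked term by term. In term l, [hcoef_qpow_hX] applies at index
    j - l and parameter m - l; raising k by one brings a factor q^l, which turns its coefficients
    into those at j and m. *)
Lemma krawtchouk_Sr i k j m : q%:R != 0 :> R ->
  krawtchouk i k.+1 j.+1 m
    = q%:R ^+ j.+1 * krawtchouk i k j.+1 m
      + (q%:R ^ m - q%:R ^+ j) * krawtchouk i k j m.
Proof.
move=> q0; rewrite /krawtchouk !hcoef_qprod !hdeg_qpow !muln1.
(* The term l = j + 1 has a counterpart only in the sum weighted by q^(j+1), so it is split off. *)
rewrite !mulr_sumr big_ord_recr [in RHS]big_ord_recr /= subnn !hcoef_qpow0 //.
rewrite addrAC -big_split /=; congr (_ + _); last first.
  by rewrite -/(qpow q (hX R q) k.+1) hcoef_qpow0 // !mulr1 mulnS exprD mulrA.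
apply: eq_bigr => l _; have le_lj : (l <= j)%N by rewrite -ltnS.
rewrite -/(qpow q (hX R q) k.+1) subSn // hcoef_qpow_hX // mulnS exprD.
rewrite -(exprM_exprz_sub l m q0).
have qj : q%:R ^+ j = q%:R ^+ l * q%:R ^+ (j - l) :> R by rewrite -exprD subnKC.
rewrite !exprS qj; move: (hcoef (qpow q (hY R) i) l m) => A.
move: (hcoef _ (j - l).+1 _) (hcoef _ (j - l) _) => B C.
move: (q%:R ^ (m - l%:Z)) (q%:R ^+ (j - l)).
move: (q%:R) (q%:R ^+ l) (q%:R ^+ (l * k)) => x1 x2 x3 x4 x5.
ring.
Qed.

End QProductCoefficients.

(** * The subfield GF(q) of L *)

Section FixedField.
Set Implicit Arguments.
Unset Strict Implicit.
Variables (L : finFieldType) (q m : nat).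
Hypothesis hL : #|L| = (q ^ m)%N.

Lemma card_exp_gt0 : (0 < m)%N.
Proof.
by case: m hL (finNzRing_gt1 L) => // ->.
Qed.

Lemma base_gt1 : (1 < q)%N.
Proof.
have := finNzRing_gt1 L; rewrite hL.
case: q => [|[|q']] //; first by rewrite exp0n // card_exp_gt0.
by rewrite exp1n.
Qed.

(** As m > 0, q divides |L|, a power of the characteristic. Hence q-th powers are additive on L and
    on polynomials over L. *)
Lemma base_pchar_nat : [pchar L].-nat q.
Proof.
have [p p_pr charLp] := finPcharP L.
have: [pchar L].-nat (q ^ m)%N.
  rewrite -hL (eq_pnat _ (pcharf_eq charLp)).
  by have := pprimeChar_pgroup charLp; rewrite /pgroup.pgroup cardsT.
exact/pnat_dvd/dvdn_exp/dvdnn/card_exp_gt0.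
Qed.

Lemma FqE (x : L) : (x \in Fq L q) = (x ^+ q == x).
Proof. by rewrite inE. Qed.

Lemma Fq0 : 0 \in Fq L q.
Proof. by rewrite FqE expr0n gtn_eqF // ltnW ?base_gt1. Qed.

Lemma Fq1 : 1 \in Fq L q.
Proof. by rewrite FqE expr1n. Qed.

Lemma FqD (x y : L) : x \in Fq L q -> y \in Fq L q -> x + y \in Fq L q.
Proof.
by rewrite !FqE (exprDn_pchar _ _ base_pchar_nat) => /eqP-> /eqP->.
Qed.

Lemma FqN (x : L) : x \in Fq L q -> - x \in Fq L q.
Proof. by rewrite !FqE (exprNn_pchar _ base_pchar_nat) => /eqP->. Qed.

Lemma FqM (x y : L) : x \in Fq L q -> y \in Fq L q -> x * y \in Fq L q.
Proof. by rewrite !FqE exprMn => /eqP-> /eqP->. Qed.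

Lemma FqV (x : L) : x \in Fq L q -> x^-1 \in Fq L q.
Proof. by rewrite !FqE exprVn => /eqP->. Qed.

Lemma dvdp_XnsubX : ('X^q - 'X : {poly L}) %| 'X^#|L| - 'X.
Proof.
rewrite hL; elim: m => [|e IHe]; first by rewrite expn0 subrr dvdp0.
have pcharP : [pchar {poly L}].-nat q.
  by rewrite (eq_pnat _ (pchar_poly L)) base_pchar_nat.
have -> : ('X^(q ^ e.+1) - 'X : {poly L}) = ('X^(q ^ e) - 'X) ^+ q + ('X^q - 'X).
  by rewrite exprDn_pchar // exprNn_pchar // -exprM -expnSr addrA subrK.
by rewrite dvdp_addl // dvdp_exp // ltnW ?base_gt1.
Qed.

(** X^q - X divides the product of all X - x with x in L, so it splits into distinct linear factors
    and has exactly q roots. *)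
Lemma card_Fq : #|Fq L q| = q.
Proof.
have q_gt1 := base_gt1.
have size_XqX : size ('X^q - 'X : {poly L}) = q.+1.
  by rewrite size_polyDl size_polyXn // size_polyN size_polyX.
have XqX_dvd := dvdp_XnsubX; rewrite finField_genPoly in XqX_dvd.
have [s eq_s] := dvdp_prod_XsubC XqX_dvd.
set r := mask s _ in eq_s.
have r_uniq : uniq r by rewrite mask_uniq ?index_enum_uniq.
have -> : Fq L q = [set x in r].
  apply/setP=> x; rewrite FqE inE -root_prod_XsubC -(eqp_root eq_s).
  by rewrite rootE !hornerE subr_eq0.
rewrite cardsE (card_uniqP r_uniq); apply: succn_inj.
by rewrite -size_XqX (eqp_size eq_s) size_prod_XsubC.
Qed.

Lemma Fq_sum (I : finType) (P : pred I) (f : I -> L) :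
  (forall i, P i -> f i \in Fq L q) -> \sum_(i | P i) f i \in Fq L q.
Proof.
by move=> Ff; elim/big_ind: _ => //; [exact: Fq0 | exact: FqD].
Qed.

(** * Spans of coordinates over GF(q) and the rank *)

Section Dotp.
Variable n : nat.
Implicit Types (u v w : 'rV[L]_n) (S : {set 'I_n}).

Lemma dotpE u v : dotp u v = (u *m v^T) 0 0.
Proof. by rewrite mxE; apply: eq_bigr => i _; rewrite mxE. Qed.

Lemma dotpC u v : dotp u v = dotp v u.
Proof. by apply: eq_bigr => i _; rewrite mulrC. Qed.

Lemma dotpDl u v w : dotp (u + v) w = dotp u w + dotp v w.
Proof. by rewrite !dotpE mulmxDl mxE. Qed.

Lemma dotpZl x u v : dotp (x *: u) v = x * dotp u v.
Proof. by rewrite !dotpE -scalemxAl mxE. Qed.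

Lemma dotpBl u v w : dotp (u - v) w = dotp u w - dotp v w.
Proof. by rewrite dotpDl -[- v]scaleN1r dotpZl mulN1r. Qed.

Lemma dotp0l v : dotp 0 v = 0.
Proof. by rewrite dotpE mul0mx mxE. Qed.

Lemma dotpDr u v w : dotp u (v + w) = dotp u v + dotp u w.
Proof. by rewrite !(dotpC u) dotpDl. Qed.

Lemma dotpZr x u v : dotp u (x *: v) = x * dotp u v.
Proof. by rewrite !(dotpC u) dotpZl. Qed.

Lemma dotp_delta i v : dotp (delta_mx 0 i) v = v 0 i.
Proof. by rewrite dotpE -rowE !mxE. Qed.

Definition Fqrow : {set 'rV[L]_n} :=
  [set c : 'rV[L]_n | [forall i, c 0 i \in Fq L q]].

Lemma FqrowP (c : 'rV[L]_n) :
  reflect (forall i, c 0 i \in Fq L q) (c \in Fqrow).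
Proof. by rewrite inE; apply: forallP. Qed.

Lemma Fqrow0 : 0 \in Fqrow.
Proof. by apply/FqrowP=> i; rewrite mxE Fq0. Qed.

Lemma FqrowD u v : u \in Fqrow -> v \in Fqrow -> u + v \in Fqrow.
Proof. by move=> /FqrowP Fu /FqrowP Fv; apply/FqrowP=> i; rewrite mxE FqD. Qed.

Lemma FqrowZ x u : x \in Fq L q -> u \in Fqrow -> x *: u \in Fqrow.
Proof. by move=> Fx /FqrowP Fu; apply/FqrowP=> i; rewrite mxE FqM. Qed.

Lemma FqrowB u v : u \in Fqrow -> v \in Fqrow -> u - v \in Fqrow.
Proof.
by move=> Fu Fv; rewrite FqrowD // -scaleN1r FqrowZ // FqN // Fq1.
Qed.

Definition Fqrow_supp S : {set 'rV[L]_n} :=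
  [set c : 'rV[L]_n | (c \in Fqrow) && [forall i, (i \notin S) ==> (c 0 i == 0)]].

Lemma card_Fqrow_supp S : #|Fqrow_supp S| = (q ^ #|S|)%N.
Proof.
rewrite -[in RHS]card_Fq -(card_pffun_on 0 (mem S) (mem (Fq L q))).
pose row_of (f : {ffun 'I_n -> L}) := \row_i f i.
have row_of_inj : injective row_of.
  by move=> f g /rowP eq_fg; apply/ffunP=> i; move: (eq_fg i); rewrite !mxE.
rewrite -(card_imset _ row_of_inj); apply: eq_card => c; rewrite !inE.
apply/andP/imsetP=> [[/forallP Fc /forallP Sc] | [f /pfamilyP[/subsetP Sf Ff] ->]].
  exists [ffun i => c 0 i]; last by apply/rowP=> i; rewrite mxE ffunE.
  apply/pfamilyP; split=> [|i _]; last by rewrite ffunE Fc.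
  apply/subsetP=> i; rewrite inE ffunE; apply: contraNT => iS.
  exact: implyP (Sc i) iS.
split; apply/forallP=> i.
  rewrite mxE; have [iS|iS] := boolP (i \in S); first exact: Ff.
  by move: (contra (Sf i) iS); rewrite inE negbK => /eqP->; exact: Fq0.
by apply/implyP=> iS; rewrite mxE; move: (contra (Sf i) iS); rewrite inE negbK.
Qed.

Lemma card_Fqrow : #|Fqrow| = (q ^ n)%N.
Proof.
rewrite -[n in RHS]card_ord -cardsT -card_Fqrow_supp.
apply: eq_card => c; rewrite [RHS]inE.
have -> : [forall i, (i \notin [set: 'I_n]) ==> (c 0 i == 0)].
  by apply/forallP=> i; rewrite inE.
by rewrite andbT.
Qed.

(** The GF(q)-span of the coordinates of v, kept as a plain set: its dimension is read off its
    cardinality. *)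
Definition lspan v : {set L} := [set dotp c v | c in Fqrow].

Lemma lspanP v x :
  reflect (exists2 c, c \in Fqrow & x = dotp c v) (x \in lspan v).
Proof. exact: imsetP. Qed.

Lemma lspan0 v : 0 \in lspan v.
Proof. by apply/lspanP; exists 0; rewrite ?Fqrow0 ?dotp0l. Qed.

Lemma lspanD v x y : x \in lspan v -> y \in lspan v -> x + y \in lspan v.
Proof.
move=> /lspanP[c Fc ->] /lspanP[d Fd ->].
by apply/lspanP; exists (c + d); rewrite ?dotpDl ?FqrowD.
Qed.

Lemma lspanZ v a x : a \in Fq L q -> x \in lspan v -> a * x \in lspan v.
Proof.
move=> Fa /lspanP[c Fc ->].
by apply/lspanP; exists (a *: c); rewrite ?dotpZl ?FqrowZ.
Qed.

(** A largest independent set S of coordinates is a basis of the span, so combinations supported on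
    S reach each element exactly once. Later rank computations go through this cardinality. *)
Lemma card_lspan v : #|lspan v| = (q ^ rk q v)%N.
Proof.
have indep0 : coords_indep q v set0.
  by apply/forallP=> c; apply/implyP=> _; apply/forallP=> i; rewrite inE.
have ex_indep : (0 < #|[pred S | coords_indep q v S]|)%N.
  by apply/card_gt0P; exists set0.
have [S indepS rkS] := eq_bigmax_cond (fun S : {set 'I_n} => #|S|) ex_indep.
have rk_max T : coords_indep q v T -> (#|T| <= rk q v)%N.
  by move=> indepT; rewrite /rk leq_bigmax_cond.
have {}rkS : rk q v = #|S| by rewrite -rkS.
pose D := Fqrow_supp S.
have DP (c : 'rV[L]_n) : reflect ((forall i, c 0 i \in Fq L q)
    /\ (forall i, i \notin S -> c 0 i = 0)) (c \in D).
  rewrite inE; apply: (iffP andP) => [[/FqrowP Fc /forallP Sc] | [Fc Sc]].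
    by split=> // i iS; apply/eqP/(implyP (Sc i)).
  by split; [exact/FqrowP | apply/forallP=> i; apply/implyP=> /Sc/eqP].
have D_lin a c d : a \in Fq L q -> c \in D -> d \in D -> a *: c + d \in D.
  move=> Fa /DP[Fc Sc] /DP[Fd Sd]; apply/DP; split=> i.
    by rewrite !mxE FqD // FqM.
  by move=> iS; rewrite !mxE Sc // Sd // mulr0 addr0.
have D0 : 0 \in D by apply/DP; split=> i; rewrite mxE ?Fq0.
have dotpS c : c \in D -> dotp c v = \sum_(i in S) c 0 i * v 0 i.
  move=> /DP[_ Sc]; rewrite /dotp (bigID (mem S)) /=.
  by rewrite [X in _ + X]big1 ?addr0 // => i /Sc->; rewrite mul0r.
have D_inj0 c : c \in D -> dotp c v = 0 -> c = 0.
  move=> Dc; rewrite dotpS // => c0; have [Fc Sc] := DP c Dc.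
  have /forallP cS : [forall i in S, [ffun i => c 0 i] i == 0].
    apply: implyP (forallP indepS [ffun i => c 0 i]) _.
    apply/andP; split; first by apply/forallP=> i; rewrite ffunE Fc implybT.
    by apply/eqP; rewrite -[RHS]c0; apply: eq_bigr => i _; rewrite ffunE.
  apply/rowP=> i; rewrite mxE.
  have [iS|/Sc//] := boolP (i \in S).
  by have := implyP (cS i) iS; rewrite ffunE => /eqP.
rewrite rkS -card_Fqrow_supp -/D.
suff -> : lspan v = [set dotp c v | c in D].
  apply: card_in_imset => c d Dc Dd eq_cd; apply/eqP; rewrite -subr_eq0.
  rewrite -[c - d]addrC -scaleN1r; apply/eqP/D_inj0.
    by rewrite D_lin // FqN // Fq1.
  by rewrite dotpDl dotpZl eq_cd mulN1r addNr.
(* Maximality of S: for i outside S, the larger set carries a nontrivial relation [c]. Its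
   coefficient at i is nonzero because S is independent, so the relation can be solved for the
   coordinate i. *)
have v_in i : exists2 c, c \in D & v 0 i = dotp c v.
  have [iS|iS] := boolP (i \in S).
    exists (delta_mx 0 i); last by rewrite dotp_delta.
    apply/DP; split=> j; rewrite mxE eqxx /=.
      by case: (_ == _); rewrite ?Fq0 ?Fq1.
    by have [->|//] := eqVneq j i; rewrite iS.
  have: ~~ coords_indep q v (i |: S).
    by apply: contraL iS => /rk_max; rewrite rkS cardsU1; case: (i \in S); rewrite // add1n ltnn.
  case/forallPn=> c; rewrite negb_imply => /andP[/andP[/forallP Fc c0] cN0].
  have {}Fc j : j \in i |: S -> c j \in Fq L q by move/(implyP (Fc j)).
  rewrite big_setU1 //= in c0.
  pose d := \row_j (if j \in S then c j else 0).
  have Dd : d \in D.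
    apply/DP; split=> j; rewrite mxE; last by move/negbTE->.
    by case: ifP => jS; rewrite ?Fq0 // Fc // inE jS orbT.
  have dE : \sum_(j in S) c j * v 0 j = dotp d v.
    by rewrite dotpS //; apply: eq_bigr => j jS; rewrite mxE jS.
  have ci0 : c i != 0.
    apply: contra cN0 => ci0; apply/forallP=> j; apply/implyP.
    rewrite dE (eqP ci0) mul0r add0r in c0.
    rewrite in_setU1 => /predU1P[->//|jS].
    by have /rowP/(_ j) := D_inj0 d Dd (eqP c0); rewrite !mxE jS => ->.
  exists (- (c i)^-1 *: d).
    by rewrite -[_ *: _]addr0 D_lin // FqN // FqV // Fc // setU11.
  rewrite dotpZl -dE; apply: (mulfI ci0).
  move: c0; rewrite addr_eq0 => /eqP ->.
  by rewrite mulNr mulrN mulVKf.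
apply/setP=> x; apply/lspanP/imsetP=> [[c /FqrowP Fc ->] | [c Dc ->]]; last first.
  by exists c => //; move: Dc; rewrite inE => /andP[].
rewrite [dotp c v]/dotp; elim/big_ind: _ => [|_ _ [a Da ->] [b Db ->]|i _].
- by exists 0; rewrite ?dotp0l.
- by exists (a + b); rewrite ?dotpDl // -[a]scale1r D_lin // Fq1.
- have [d Dd ->] := v_in i; exists (c 0 i *: d); rewrite ?dotpZl //.
  by rewrite -[_ *: _]addr0 D_lin.
Qed.

Lemma rk_leq v : (rk q v <= n)%N.
Proof.
by rewrite -(leq_exp2l _ _ base_gt1) -card_lspan -card_Fqrow leq_imset_card.
Qed.

(** Both sides say that c |-> c.v is injective on GF(q)^n, its image having q^(rk v) elements. *)
Lemma rk_full v : (rk q v == n) = [forall c in Fqrow, (dotp c v == 0) ==> (c == 0)].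
Proof.
rewrite -(eqn_exp2l _ _ base_gt1) -card_lspan -card_Fqrow.
apply/imset_injP/forall_inP=> [inj c Fc | inj c d Fc Fd eq_cd].
  apply/implyP=> /eqP c0; apply/eqP/inj; rewrite ?Fqrow0 //.
  by rewrite c0 dotp0l.
apply/eqP; rewrite -subr_eq0; have /implyP := inj _ (FqrowB Fc Fd); apply.
by rewrite dotpBl eq_cd subrr.
Qed.

Lemma rk_eq0 v : (rk q v == 0) = (v == 0).
Proof.
rewrite -(eqn_exp2l _ _ base_gt1) -card_lspan expn0.
apply/eqP/eqP => [/eqP/cards1P[x vx] | ->].
  apply/rowP=> i; rewrite mxE -dotp_delta.
  have: dotp (delta_mx 0 i) v \in lspan v.
    apply/lspanP; exists (delta_mx 0 i) => //; apply/FqrowP=> j.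
    by rewrite mxE; case: (_ && _); rewrite ?Fq0 ?Fq1.
  have := lspan0 v; rewrite vx !inE => /eqP<- /eqP; exact.
rewrite -[RHS](cards1 (0 : L)); apply: eq_card => x; rewrite inE.
apply/lspanP/eqP=> [[c _ ->]|->]; first by rewrite dotpC dotp0l.
by exists 0; rewrite ?Fqrow0 ?dotp0l.
Qed.

(* c |-> c.v is an additive surjection of GF(q)^n onto the span of v, so all
   its fibres have the same size q^n / q^(rk v). *)
Lemma sum_lspan (R : realFieldType) (f : L -> R) v :
  \sum_(t in lspan v) f t
    = q%:R ^+ rk q v / q%:R ^+ n * \sum_(c in Fqrow) f (dotp c v).
Proof.
pose fib t := #|[set c in Fqrow | dotp c v == t]|.
have fibE t : t \in lspan v -> fib t = fib 0.
  case/lspanP=> d Fd ->; rewrite /fib -[RHS](card_imset _ (addrI d)); apply: eq_card.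
  move=> c; rewrite inE; apply/andP/imsetP=> [[Fc /eqP cd] | [e]].
    exists (c - d); last by rewrite addrC subrK.
    by rewrite inE FqrowB //= dotpBl cd subrr.
  by rewrite inE => /andP[Fe /eqP e0] ->; rewrite FqrowD // dotpDl e0 addr0.
have partF (h : L -> R) : \sum_(c in Fqrow) h (dotp c v)
    = (fib 0)%:R * \sum_(t in lspan v) h t.
  rewrite (partition_big_imset (fun c => dotp c v)) -/(lspan v) mulr_sumr; apply: eq_bigr => t vt.
  rewrite (eq_bigr (fun=> h t)); last by move=> c /andP[_ /eqP->].
  rewrite sumr_const -(fibE t vt) mulr_natl; congr (_ *+ _).
  by apply: eq_card => c; rewrite inE.
have q_neq0 e : q%:R ^+ e != 0 :> R.
  by rewrite expf_neq0 // pnatr_eq0 -lt0n ltnW // base_gt1.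
(* The constant function 1 determines the size of a fibre: q^n = [fib 0] * q^(rk v). *)
have := partF (fun=> 1).
rewrite !sumr_const card_Fqrow card_lspan !natrX partF => qnE.
have fib_neq0 : (fib 0)%:R != 0 :> R.
  by apply: contraNneq (q_neq0 n) => fib0; rewrite qnE fib0 mul0r.
by rewrite qnE invfM [X in X * _]mulrCA divff // mulr1 mulKf.
Qed.

End Dotp.

(** * Splitting off the first coordinate *)

Definition rvcons n (x : L) (v : 'rV[L]_n) : 'rV[L]_n.+1 :=
  row_mx (x%:M : 'rV_1) v.

Lemma rvcons0 n x (v : 'rV[L]_n) : rvcons x v 0 0 = x.
Proof.
transitivity (rvcons x v 0 (lshift n (0 : 'I_1))).
  by congr (rvcons x v 0 _); apply: val_inj.
by rewrite [LHS](row_mxEl (x%:M : 'M_1) v) mxE.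
Qed.

Lemma rvconsS n x (v : 'rV[L]_n) i : rvcons x v 0 (lift 0 i) = v 0 i.
Proof.
transitivity (rvcons x v 0 (rshift 1 i)); last exact: row_mxEr.
by congr (rvcons x v 0 _); apply: val_inj.
Qed.

Lemma rvconsP n (v : 'rV[L]_n.+1) :
  v = rvcons (v 0 0) (\row_i v 0 (lift 0 i)).
Proof.
apply/rowP=> i; case: (unliftP 0 i) => [j|] ->; last by rewrite rvcons0.
by rewrite rvconsS mxE.
Qed.

Lemma dotp_rvcons n x y (u v : 'rV[L]_n) :
  dotp (rvcons x u) (rvcons y v) = x * y + dotp u v.
Proof.
rewrite /dotp big_ord_recl !rvcons0; congr (_ + _).
by apply: eq_bigr => i _; rewrite !rvconsS.
Qed.

Lemma sum_rvcons (R : nmodType) n (P : pred 'rV[L]_n.+1) (F : 'rV[L]_n.+1 -> R) :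
  \sum_(u | P u) F u
    = \sum_(u : 'rV[L]_n) \sum_(x | P (rvcons x u)) F (rvcons x u).
Proof.
rewrite pair_big_dep /=.
rewrite (reindex (fun p : 'rV[L]_n * L => rvcons p.2 p.1)) //.
exists (fun u : 'rV[L]_n.+1 => (\row_i u 0 (lift 0 i), u 0 0)) => [[u x] _|u _].
  congr (_, _); last exact: rvcons0.
  by apply/rowP=> i; rewrite mxE rvconsS.
by rewrite -rvconsP.
Qed.

Lemma rvcons_Fqrow n x (v : 'rV[L]_n) :
  (rvcons x v \in Fqrow n.+1) = (x \in Fq L q) && (v \in Fqrow n).
Proof.
apply/FqrowP/andP=> [Fxv | [Fx /FqrowP Fv] i].
  split; first by have := Fxv 0; rewrite rvcons0.
  by apply/FqrowP=> i; have := Fxv (lift 0 i); rewrite rvconsS.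
by case: (unliftP 0 i) => [j|] ->; rewrite ?rvcons0 ?rvconsS.
Qed.

Lemma lspan_rvconsP n b (v : 'rV[L]_n) x :
  reflect (exists a s, [/\ a \in Fq L q, s \in lspan v & x = a * b + s])
          (x \in lspan (rvcons b v)).
Proof.
apply: (iffP (lspanP _ _)) => [[c] | [a [s [Fa /lspanP[c Fc ->] ->]]]].
  rewrite (rvconsP c) rvcons_Fqrow => /andP[Fa Fc] ->.
  do 2![eexists]; rewrite dotp_rvcons; split; first exact: Fa; last by [].
  exact: imset_f.
by exists (rvcons a c); rewrite ?rvcons_Fqrow ?Fa // dotp_rvcons.
Qed.

(** Adjoining b leaves the span unchanged if b already lies in it; otherwise (a, s) |-> a b + s is
    injective and the span grows by a factor q. *)
Lemma rk_rvcons n b (v : 'rV[L]_n) :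
  rk q (rvcons b v) = ((b \notin lspan v) + rk q v)%N.
Proof.
apply/eqP; rewrite -(eqn_exp2l _ _ base_gt1) expnD -!card_lspan.
have [bv|bv] := boolP (b \in _).
  rewrite mul1n; apply/eqP/eq_card => x.
  apply/lspan_rvconsP/idP=> [[a [s [Fa vs ->]]] | vx].
    by rewrite lspanD // lspanZ.
  by exists 0, x; split; rewrite ?Fq0 // mul0r add0r.
rewrite -[X in (X ^ _)%N]card_Fq expn1 -cardsX; apply/eqP.
pose h (p : L * L) := p.1 * b + p.2.
rewrite -(@card_in_imset _ _ h); last first.
  move=> [a s] [a' s']; rewrite !in_setX /= => /andP[Fa vs] /andP[Fa' vs'].
  rewrite /h /= => eq_h; have [eq_a|neq_a] := eqVneq a a'.
    by move: eq_h; rewrite eq_a => /addrI->.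
  case/negP: bv; rewrite -subr_eq0 in neq_a.
  have -> : b = (a - a')^-1 * (s' + (-1) * s).
    apply: (mulfI neq_a); rewrite mulVKf // mulrBl; apply/eqP.
    by rewrite mulN1r subr_eq addrAC eq_sym subr_eq [s' + _]addrC eq_h.
  rewrite lspanZ ?FqV ?FqD ?FqN // lspanD // lspanZ ?FqN ?Fq1 //.
apply: eq_card => x; apply/lspan_rvconsP/imsetP.
  by case=> a [s [Fa vs ->]]; exists (a, s); rewrite // in_setX Fa.
by case=> [[a s]]; rewrite in_setX => /andP[Fa vs] ->; exists a, s.
Qed.

(** * Changes of coordinates over GF(q) *)

Definition Fqmx n (A : 'M[L]_n) : Prop := forall i j, A i j \in Fq L q.

Section BaseChange.
Variables (n : nat) (A B : 'M[L]_n).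
Hypotheses (FA : Fqmx A) (FB : Fqmx B) (AB : A *m B = 1%:M).

Lemma dotp_mulmx (u v : 'rV[L]_n) (M : 'M[L]_n) :
  dotp u (v *m M) = dotp (u *m M^T) v.
Proof. by rewrite !dotpE trmx_mul mulmxA. Qed.

Lemma lspan_mulmx_sub (v : 'rV[L]_n) (M : 'M[L]_n) :
  Fqmx M -> lspan (v *m M) \subset lspan v.
Proof.
move=> FM; apply/subsetP=> _ /lspanP[c /FqrowP Fc ->]; rewrite dotp_mulmx.
apply/lspanP; eexists; last by [].
by apply/FqrowP=> i; rewrite mxE Fq_sum // => k _; rewrite mxE FqM.
Qed.

(** A matrix over GF(q) can only shrink the span; [A] and its inverse [B] give both inclusions. *)
Lemma rk_mulmx (v : 'rV[L]_n) : rk q (v *m A) = rk q v.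
Proof.
apply/eqP; rewrite -(eqn_exp2l _ _ base_gt1) -!card_lspan eqn_leq.
rewrite !subset_leq_card ?lspan_mulmx_sub //.
by have := lspan_mulmx_sub (v *m A) FB; rewrite -mulmxA AB mulmx1.
Qed.

End BaseChange.

(** * The averaged character and its sums over vectors of given rank *)

Section Character.
Variable R : realFieldType.

(* The mean of all nontrivial additive characters of L.  Being constant on L^*,
   it has rational values, and since codes are invariant under scaling it does
   the work of a single character. *)
Definition kappa (x : L) : R := if x == 0 then 1 else - (#|L|%:R - 1)^-1.

Lemma sum_kappa : \sum_x kappa x = 0.
Proof.
rewrite (bigD1 0) //= {1}/kappa eqxx (eq_bigr (fun=> - (#|L|%:R - 1)^-1)).
  rewrite sumr_const cardC1 mulNrn -[_ *+ #|L|.-1]mulr_natr -subn1 natrB ?(ltnW (finNzRing_gt1 _)) //.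
  rewrite mulVf ?subrr // subr_eq0 pnatr_eq1.
  by rewrite gtn_eqF // finNzRing_gt1.
by rewrite /kappa => x /negbTE->.
Qed.

(** For b nonzero, t |-> x + t b permutes L, so the sum is that of [sum_kappa]. *)
Lemma sum_kappa_line (x b : L) :
  \sum_t kappa (x + t * b) = (b == 0)%:R * #|L|%:R * kappa x.
Proof.
have [->|b0] := eqVneq b 0.
  under eq_bigr do rewrite mulr0 addr0.
  by rewrite sumr_const mul1r mulr_natl.
rewrite !mul0r -[RHS]sum_kappa [RHS](reindex (fun t => x + t * b)) //.
exists (fun t => (t - x) / b) => t _; first by rewrite addrC addKr mulfK.
by rewrite divfK // addrC subrK.
Qed.

Definition krank n j (v : 'rV[L]_n) : R :=
  \sum_(u : 'rV[L]_n | rk q u == j) kappa (dotp u v).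

Lemma krank0 n (v : 'rV[L]_n) : krank 0 v = 1.
Proof.
rewrite /krank (eq_bigl (fun u => u == 0)); last by move=> u; rewrite rk_eq0.
by rewrite big_pred1_eq dotp0l /kappa eqxx.
Qed.

(** The transpose of [A] moves to the other argument of the inner product and permutes the vectors u
    of rank j. *)
Lemma krank_mulmx n j (A B : 'M[L]_n) (v : 'rV[L]_n) :
  Fqmx A -> Fqmx B -> A *m B = 1%:M -> krank j (v *m A) = krank j v.
Proof.
move=> FA FB AB; have BA := mulmx1C AB.
have trF M : Fqmx M -> Fqmx M^T by move=> FM i k; rewrite mxE.
rewrite /krank [RHS](reindex (fun u : 'rV[L]_n => u *m A^T)) /=; last first.
  by exists (fun u => u *m B^T) => u _;
    rewrite -mulmxA -trmx_mul ?AB ?BA trmx1 mulmx1.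
apply: eq_big => u; last by rewrite dotp_mulmx.
by rewrite (@rk_mulmx _ _ B^T) //; [exact: trF | exact: trF | rewrite -trmx_mul BA trmx1].
Qed.

(** Writing t = c.u gives u.v + t b = u.(v + b c); then the two sums are exchanged. *)
Lemma sum_lspan_kappa n w b (v : 'rV[L]_n) :
  \sum_(u : 'rV[L]_n | rk q u == w) \sum_(t in lspan u) kappa (dotp u v + t * b)
    = q%:R ^+ w / q%:R ^+ n * \sum_(c in Fqrow n) krank w (v + b *: c).
Proof.
rewrite exchange_big /= mulr_sumr; apply: eq_bigr => u /eqP rk_u.
rewrite sum_lspan rk_u; congr (_ * _); apply: eq_bigr => c _.
by rewrite dotpDr dotpZr (dotpC _ u) [b * _]mulrC.
Qed.

(** A vector (x, u) has rank j + 1 when rk u = j + 1 and x lies in the span of u, or rk u = j and x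
    lies outside. The sum over x outside is the sum over all of L, which vanishes unless b = 0,
    minus the sum over the span. *)
Lemma krank_rvcons n j b (v : 'rV[L]_n) :
  krank j.+1 (rvcons b v)
    = q%:R ^+ j.+1 / q%:R ^+ n * (\sum_(c in Fqrow n) krank j.+1 (v + b *: c))
      - q%:R ^+ j / q%:R ^+ n * (\sum_(c in Fqrow n) krank j (v + b *: c))
      + (b == 0)%:R * #|L|%:R * krank j v.
Proof.
pose S u := \sum_(t in lspan u) kappa (dotp u v + t * b).
(* Indicators put all sums over the same index u, so that the identity can be compared for each
   u. *)
have sum_ind w (F : 'rV[L]_n -> R) :
    \sum_(u | rk q u == w) F u = \sum_u (rk q u == w)%:R * F u.
  by rewrite big_mkcond; apply: eq_bigr => u _; case: eqP; rewrite ?mul1r ?mul0r.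
rewrite -!sum_lspan_kappa /krank sum_rvcons !sum_ind mulr_sumr -sumrB -big_split /=.
apply: eq_bigr => u _; rewrite -/(S u).
rewrite (eq_bigl (fun x => (x \notin lspan u) + rk q u == j.+1)%N); last first.
  by move=> x; rewrite rk_rvcons.
rewrite (eq_bigr (fun x => kappa (dotp u v + x * b))); last first.
  by move=> x _; rewrite dotp_rvcons addrC.
rewrite mulrCA -sum_kappa_line.
have [rk_u|rk_neqSj] := eqVneq (rk q u) j.+1.
  rewrite rk_u gtn_eqF // !mul0r subr0 addr0 mul1r; apply: eq_bigl => x.
  by rewrite -[X in _ == X]add0n eqn_add2r eqb0 negbK.
have [rk_u|rk_neqj] := eqVneq (rk q u) j.
  rewrite rk_u [X in _ = _ + _ * X](bigID (mem (lspan u))) /= -/(S u) mul0r !mul1r sub0r addKr.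
  by apply: eq_bigl => x; rewrite -[X in _ == X]add1n eqn_add2r eqb1.
rewrite !mul0r subr0 addr0 big_pred0 // => x.
by case: (_ \notin _); rewrite ?add0n ?add1n ?eqSS; apply/negbTE.
Qed.

End Character.

(** * Evaluation of the rank sums *)

(** A nontrivial relation c.v = 0 over GF(q) exists. A transposition brings a nonzero coefficient of
    c to the front, and a shear then clears the first coordinate of v. *)
Lemma krank_drop_dependent (R : realFieldType) n (v : 'rV[L]_n.+1) :
  rk q v != n.+1 ->
  exists2 w : 'rV[L]_n, rk q w = rk q v
    & forall j, krank R j v = krank R j (rvcons 0 w).
Proof.
rewrite rk_full negb_forall_in => /exists_inP[c Fc].
rewrite negb_imply => /andP[/eqP cv0 /rV0Pn[k ck0]].
have tperm_sq : tperm_mx 0 k *m tperm_mx 0 k = 1%:M :> 'M[L]_n.+1.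
  by rewrite -perm_mxM tperm2 perm_mx1.
have F_tperm : Fqmx (tperm_mx 0 k : 'M[L]_n.+1).
  by move=> i j; rewrite !mxE; case: (_ == _); rewrite ?Fq0 ?Fq1.
pose v1 := v *m tperm_mx 0 k; pose c1 := c *m tperm_mx 0 k.
have rk_v1 : rk q v1 = rk q v by apply: (rk_mulmx F_tperm F_tperm).
have krank_v1 j : krank R j v1 = krank R j v.
  exact: krank_mulmx tperm_sq.
have cv1 : dotp c1 v1 = 0.
  by rewrite dotp_mulmx -mulmxA tr_perm_mx tpermV tperm_sq mulmx1.
have Fc1 : c1 \in Fqrow n.+1.
  apply/FqrowP=> i; rewrite mxE Fq_sum // => k' _.
  by rewrite FqM //; apply: (FqrowP _ Fc).
have c1_0 : c1 0 0 = c 0 k by rewrite /c1 -xcolE !mxE tpermL.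
move: rk_v1 krank_v1 cv1 Fc1 c1_0; rewrite (rvconsP c1) (rvconsP v1).
set w := \row_i v1 _ _; set d := \row_i c1 _ _; move: (v1 0 0) (c1 0 0) => b a.
rewrite dotp_rvcons rvcons_Fqrow rvcons0 => rk_v1 krank_v1 cv1 /andP[Fa Fd] a_eq.
have a0 : a != 0 by rewrite a_eq.
(* Right multiplication by [shear e] sends (b, w) to (b + w.e, w). With e = a^-1 d, the relation a b
   + d.w = 0 makes the first entry 0. *)
pose shear (e : 'cV[L]_n) : 'M[L]_n.+1 := block_mx (1%:M : 'M_1) 0 e 1%:M.
have F_shear (e : 'cV[L]_n) : (forall i, e i 0 \in Fq L q) -> Fqmx (shear e).
  move=> Fe i j; rewrite !mxE; case: split => i'; rewrite !mxE.
    by case: split => j'; rewrite !mxE ?Fq0 //; case: (_ == _); rewrite ?Fq0 ?Fq1.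
  case: split => j'; rewrite ?mxE ?ord1 //.
  by case: (_ == _); rewrite ?Fq0 ?Fq1.
have shearN e : shear e *m shear (- e) = 1%:M.
  rewrite [LHS](mulmx_block (1%:M : 'M_1) 0 e 1%:M 1%:M 0 (- e) 1%:M).
  rewrite !mul1mx !mul0mx !mulmx1 !mulmx0 addr0 !add0r subrr.
  exact/esym/(scalar_mx_block 1 n 1).
have Fe i : (a^-1 *: d^T) i 0 \in Fq L q.
  by rewrite mxE [X in _ * X]mxE FqM ?FqV //; apply: (FqrowP _ Fd).
have F1 := F_shear _ Fe.
have F2 : Fqmx (shear (- (a^-1 *: d^T))).
  by apply: F_shear => i; rewrite mxE FqN.
have v1_shear : rvcons b w *m shear (a^-1 *: d^T) = rvcons 0 w.
  rewrite [LHS](mul_row_block (b%:M : 'M_1) w 1%:M 0 (a^-1 *: d^T) 1%:M).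
  rewrite !mulmx1 mulmx0 add0r /rvcons.
  apply: (congr1 (fun x : 'rV_1 => row_mx x w : 'rV_(1 + n))).
  apply/matrixP=> i j; rewrite !ord1 -scalemxAr [LHS]mxE [X in _ + X]mxE -dotpE dotpC.
  rewrite !mxE /= !mulr1n; apply: (mulfI a0).
  by rewrite mulrDr mulVKf // cv1 mulr0.
have rk_w : rk q (rvcons 0 w) = rk q v.
  by rewrite -v1_shear (rk_mulmx F1 F2) ?shearN.
exists w => [|j]; first by rewrite -rk_w rk_rvcons lspan0.
by rewrite -krank_v1 -v1_shear (krank_mulmx R _ _ F1 F2) ?shearN.
Qed.

Lemma krankE (R : realFieldType) n j (v : 'rV[L]_n) :
  krank R j v = krawtchouk R q (rk q v) (n - rk q v) j m%:Z.
Proof.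
have q0 : q%:R != 0 :> R by rewrite pnatr_eq0 -lt0n ltnW // base_gt1.
have sum_cst k i (F : 'rV[L]_k -> R) x : {in Fqrow k, forall c, F c = x} ->
    q%:R ^+ i / q%:R ^+ k * \sum_(c in Fqrow k) F c = q%:R ^+ i * x.
  move=> Fx; rewrite (eq_bigr _ Fx) sumr_const card_Fqrow.
  by rewrite -[x *+ _]mulr_natl natrX mulrA divfK // expf_neq0.
elim: n j v => [|n IHn] [|j] v; rewrite ?krank0 ?krawtchouk0 //.
  rewrite krawtchouk_gt; last by rewrite subnKC ?rk_leq.
  by apply: big_pred0 => u; apply/eqP=> rk_u; have := rk_leq u; rewrite rk_u.
have [rk_v|rk_v] := eqVneq (rk q v) n.+1; last first.
  (* Here b = 0: all translates w + b c equal w, and the last term of [krank_rvcons] contributes q^m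
     K_j(w). *)
  have [w <- ->] := krank_drop_dependent R rk_v.
  have shift0 i : {in Fqrow n, forall c, krank R i (w + 0 *: c) = krank R i w}.
    by move=> c _; rewrite scale0r addr0.
  rewrite krank_rvcons (sum_cst _ j.+1 _ _ (shift0 _)) (sum_cst _ j _ _ (shift0 _)).
  rewrite subSn ?rk_leq // krawtchouk_Sr // !IHn eqxx mul1r hL natrX -exprnP.
  ring.
rewrite rk_v subnn; move: rk_v; rewrite (rvconsP v).
move: (v 0 0) (\row_i _) => b w /eqP; rewrite rk_full => /forall_inP inj.
have {}inj a d : a \in Fq L q -> d \in Fqrow n -> a * b + dotp d w = 0 ->
    rvcons a d = 0.
  move=> Fa Fd ad0; have /implyP := inj (rvcons a d).
  rewrite rvcons_Fqrow Fa Fd dotp_rvcons ad0 eqxx => inj_ad.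
  by apply/eqP; apply: inj_ad.
have rvcons_eq0 a (d : 'rV[L]_n) : rvcons a d = 0 -> a = 0 /\ d = 0.
  move=> ad0; split; first by rewrite -(rvcons0 a d) ad0 mxE.
  by apply/rowP=> i; rewrite -(rvconsS a d) ad0 !mxE.
have b0 : b != 0.
  apply/eqP=> b0; have [] := rvcons_eq0 1 0 (inj _ _ Fq1 (Fqrow0 _) _).
    by rewrite b0 mulr0 dotp0l addr0.
  by move/eqP; rewrite oner_eq0.
(* A relation d.(w + b c) = 0 reads (d.c) b + d.w = 0, a relation over GF(q) between the coordinates
   of v, so d = 0. *)
have rk_shift : {in Fqrow n, forall c, rk q (w + b *: c) = n}.
  move=> c /FqrowP Fc; apply/eqP; rewrite rk_full; apply/forall_inP=> d Fd.
  apply/implyP=> /eqP d0.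
  have Fdc : dotp d c \in Fq L q.
    by rewrite Fq_sum // => i _; rewrite FqM //; apply: (FqrowP _ Fd).
  have [] := rvcons_eq0 _ _ (inj _ _ Fdc Fd _); last by move=> _ ->.
  by rewrite addrC [_ * b]mulrC -dotpZr -dotpDr.
rewrite krank_rvcons (negbTE b0) !mul0r addr0 krawtchouk_Sl.
by congr (_ - _); apply: sum_cst => c Fc; rewrite IHn rk_shift // subnn.
Qed.

(** * Summation over the code *)

(** If u.w is nonzero for some w in C, translation by t w permutes C. Averaging over t in L then
    replaces each term by a vanishing line sum. *)
Lemma sum_kappa_code (R : realFieldType) n (C : {vspace 'rV[L]_n}) u :
  \sum_(v in code_set C) kappa R (dotp u v)
    = (u \in dual_code C)%:R * #|code_set C|%:R.
Proof.
have inC v : (v \in code_set C) = (v \in C) by rewrite inE.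
have [|] := boolP (u \in dual_code C); rewrite inE.
  move/forallP=> uC; rewrite mul1r -sumr_const; apply: eq_bigr => v.
  by rewrite inC => vC; rewrite /kappa (implyP (uC v) vC).
case/forallPn=> w; rewrite negb_imply => /andP[wC uw].
have shift t : \sum_(v in code_set C) kappa R (dotp u v)
    = \sum_(v in code_set C) kappa R (dotp u v + t * dotp u w).
  rewrite (reindex_inj (addIr (t *: w))) /=.
  by apply: eq_big => v; rewrite ?inC ?rpredDr ?rpredZ // dotpDr dotpZr.
have L0 : #|L|%:R != 0 :> R by rewrite pnatr_eq0 -lt0n ltnW ?finNzRing_gt1.
apply: (mulfI L0); rewrite mul0r mulr0 mulr_natl -sumr_const.
rewrite (eq_bigr _ (fun t _ => shift t)) exchange_big big1 // => v _.
by rewrite sum_kappa_line (negbTE uw) !mul0r.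
Qed.

End FixedField.

Theorem theorem2 (R : realFieldType) (L : finFieldType) (q m n k : nat)
  (hL : #|L| = (q ^ m)%N)
  (C : {vspace 'rV[L]_n}) (hk : \dim C = k) :
  forall j : nat,
    hcoef (rank_enum R q (dual_code C)) j m%:Z =
    (#|code_set C|%:R)^-1 *
      hcoef (qtransform_at q (rank_enum R q (code_set C)) (hX R q) (hY R)) j m%:Z.
Proof.
(* For j > n both coefficients are 0 by the convention in [hcoef]. *)
move=> j; rewrite {1}/hcoef [X in _ * X]/hcoef /=; case: leqP => [_|_]; last by rewrite mulr0.
have C0 : #|code_set C|%:R != 0 :> R.
  by rewrite pnatr_eq0 -lt0n; apply/card_gt0P; exists 0; rewrite inE mem0v.
apply: (mulfI C0); rewrite mulVKf // big_mkord.
(* The sum of K_j over C is computed twice. Exchanging sums gives |C| B_j by [sum_kappa_code]. *)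
transitivity (\sum_(v in code_set C) krank q R j v).
  rewrite exchange_big mulrC /rank_dist -[X in X%:R * _]sum1_card natr_sum mulr_suml big_mkcond /=.
  rewrite [RHS]big_mkcond; apply: eq_bigr => u _; rewrite sum_kappa_code.
  by rewrite inE; case: (_ \in _); case: eqP; rewrite ?mul0r.
(* Grouping the codewords by rank gives the q-transform; [inord] loses nothing since ranks are at
   most n. *)
rewrite (partition_big (fun v => inord (rk q v) : 'I_n.+1) predT) //=.
apply: eq_bigr => i _; rewrite /hcoef /= -ltnS ltn_ord /rank_dist -sum1_card natr_sum mulr_suml.
have rk_inord (v : 'rV[L]_n) : (inord (rk q v) == i) = (rk q v == i).
  by rewrite -val_eqE /= inordK // ltnS (rk_leq hL).
apply: eq_big => v; first by rewrite [in RHS]inE rk_inord.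
by case/andP=> _; rewrite rk_inord => /eqP rk_v; rewrite (krankE hL) rk_v mul1r.
Qed.
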